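(* Let $\mathcal{Q}(\theta,\omega) = \mathcal{L}_{\mathcal{S}}[G_{\theta},y] + \mathcal{L}_{\mathcal{S}}[G_{\theta},T_{\omega}]$ for $\theta\in\Theta=\mathbb{R}^p$, $\omega\in\Omega$, be as in the context. Assume: (1) for every fixed $\omega\in\Omega$, the function $\theta\mapsto\mathcal{Q}(\theta,\omega)$ is convex and $\beta$-smooth (with the same constant $\beta>0$ for all $\omega$); (2) for every $\omega\in\Omega$ the set $\arg\min_{\theta}\mathcal{Q}(\theta,\omega)$ is nonempty, and the union $\bigcup_{\omega\in\Omega}\arg\min_{\theta}\mathcal{Q}(\theta,\omega)$ is bounded; (3) for every $\theta\in\Theta$, the function $\omega\mapsto\mathcal{L}_{\mathcal{S}}[G_\theta,T_\omega]$ (equivalently $\omega\mapsto\mathcal{Q}(\theta,\omega)$) has a global minimizer in $\Omega$; (4) $\mathcal{L}_{\mathcal{S}}[G_{\theta},y]\to\infty$ as $\|\theta\|\to\infty$. Let $0<\mu<\beta^{-1}$, let $\theta_1\in\Theta$ be arbitrary, and let $\omega_1\in\arg\min_{\omega}\mathcal{Q}(\theta_1,\omega)$. For $t\ge 2$ let $$\theta_t=\theta_{t-1}-\mu\,\nabla_\theta\mathcal{Q}(\theta_{t-1},\omega_{t-1}),\qquad \omega_t\in\arg\min_{\omega}\mathcal{Q}(\theta_t,\omega).$$ Then the following limits exist and $$\lim_{t\to\infty}\mathcal{Q}(\theta_t,\omega_t)=\lim_{t\to\infty}\min_{\theta}\mathcal{Q}(\theta,\omega_t)=\lim_{t\to\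infty}\min_{\omega}\mathcal{Q}(\theta_t,\omega).$$
   Context: Let $\mathcal{X}\subset\mathbb{R}^n$ be a set of instances, $\mathcal{Y}$ a set of labels, $y:\mathcal{X}\to\mathcal{Y}$ a target function, $\ell:\mathcal{Y}^2\to[0,\infty)$ a (nonnegative) loss function, and $\mathcal{S}=\{(x_i,y(x_i))\}_{i=1}^m$ a finite sample with $x_i\in\mathcal{X}$. For functions $H,H':\mathcal{X}\to\mathcal{Y}$ define the empirical risk $\mathcal{L}_{\mathcal{S}}[H,H']:=\frac1m\sum_{i=1}^m\ell(H(x_i),H'(x_i))$. Let $\mathcal{G}=\{G_\theta\mid\theta\in\Theta\}$ and $\mathcal{T}=\{T_\omega\mid\omega\in\Omega\}$ be two hypothesis classes of functions $\mathcal{X}\to\mathcal{Y}$, where $\Theta=\mathbb{R}^p$ is a Euclidean parameter space and $\Omega$ is a parameter set. Define $\mathcal{Q}(\theta,\omega):=\mathcal{L}_{\mathcal{S}}[G_\theta,y]+\mathcal{L}_{\mathcal{S}}[G_\theta,T_\omega]$; in particular $\mathcal{Q}\ge 0$. A function on a Euclidean space is $\beta$-smooth if it is differentiable and its gradient is $\beta$-Lipschitz with respect to the Euclidean norm. *)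

(* Defs.v *)
From HB Require Import structures.
From mathcomp Require Import all_boot all_order all_algebra.
From mathcomp Require Import all_classical all_reals all_analysis.

Set Implicit Arguments.
Unset Strict Implicit.
Unset Printing Implicit Defensive.

Import Order.TTheory GRing.Theory Num.Theory.
Import numFieldNormedType.Exports.

Local Open Scope classical_set_scope.
Local Open Scope ring_scope.

(* The norm `|x| that MathComp-Analysis puts on 'rV[R]_p is the sup norm, so the
   Euclidean norm is defined here. The two norms are equivalent; hence the
   library's differentiable and bounded_set have their Euclidean meaning. *)
Definition enorm (R : realType) (p : nat) (x : 'rV[R]_p) : R :=
  Num.sqrt (\sum_(i < p) x 0 i ^+ 2).

Definition gradient (R : realType) (p : nat) (f : 'rV[R]_p -> R)
    (x : 'rV[R]_p) : 'rV[R]_p :=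
  \row_(i < p) 'D_(delta_mx 0 i) f x.

Definition smooth (R : realType) (p : nat) (beta : R) (f : 'rV[R]_p -> R) :
    Prop :=
  (forall x, differentiable f x) /\
  (forall x x',
    enorm (gradient f x - gradient f x') <= beta * enorm (x - x')).

Definition coercive (R : realType) (p : nat) (f : 'rV[R]_p -> R) : Prop :=
  forall A : R, exists r : R, forall x, r < enorm x -> A < f x.

Definition argmin (R : realType) (U : Type) (f : U -> R) : set U :=
  [set a | forall b, f a <= f b].

(* This is the minimum of f as soon as f has a minimizer: see minvalE. *)
Definition minval (R : realType) (U : Type) (f : U -> R) : R := inf (range f).

Lemma minvalE (R : realType) (U : Type) (f : U -> R) (a : U) :
  argmin f a -> minval f = f a.
Proof.
move=> fa; apply/eqP; rewrite eq_le; apply/andP; split.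
  by apply: ge_inf; [exists (f a) => _ [b _ <-]; exact: fa|exists a].
by apply: lb_le_inf; [exists (f a), a|move=> _ [b _ <-]; exact: fa].
Qed.

(* A set of instances X is used as the type of its elements (set_type); only the
   instances x i of the sample (x i, y (x i)) enter the risk. *)
Definition empirical_risk (R : realType) (n : nat) (X : set 'rV[R]_n)
    (Y : Type) (m : nat) (loss : Y -> Y -> R) (x : 'I_m -> X)
    (H H' : X -> Y) : R :=
  m%:R^-1 * \sum_(i < m) loss (H (x i)) (H' (x i)).

Definition total_risk (R : realType) (n : nat) (X : set 'rV[R]_n)
    (Y : Type) (m : nat) (loss : Y -> Y -> R) (x : 'I_m -> X) (y : X -> Y)
    (p : nat) (Omega : Type) (G : 'rV[R]_p -> X -> Y) (T : Omega -> X -> Y)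
    (theta : 'rV[R]_p) (omega : Omega) : R :=
  empirical_risk loss x (G theta) y +
  empirical_risk loss x (G theta) (T omega).

(* Main.v *)
Require Import Defs.
From HB Require Import structures.
From mathcomp Require Import all_boot all_order all_algebra.
From mathcomp Require Import all_classical all_reals all_analysis.
From mathcomp Require Import ring lra.

Set Implicit Arguments.
Unset Strict Implicit.
Unset Printing Implicit Defensive.

Import Order.TTheory GRing.Theory Num.Theory.
Import numFieldNormedType.Exports.

Local Open Scope classical_set_scope.
Local Open Scope ring_scope.

(* A gradient step decreases Q(., w) by at least a constant times the squared
   norm of the gradient, and the subsequent minimization in w can only decrease Q
   further. So the values Q(theta_t, omega_t), being nonnegative, converge, and
   the gradients g_t tend to 0. By convexity,
   Q(theta_t, omega_t) - Q(th, omega_t) <= |g_t| (|theta_t| + |th|) for th a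
   minimizer of Q(., omega_t); theta_t stays in a sublevel set of a coercive
   function and th in a bounded set, so this gap tends to 0. *)

Definition dot (R : realType) (p : nat) (u v : 'rV[R]_p) : R :=
  \sum_(i < p) u 0 i * v 0 i.

Section Euclid.
Variables (R : realType) (p : nat).
Implicit Types u v w : 'rV[R]_p.

Lemma dotBl u v w : dot (u - v) w = dot u w - dot v w.
Proof. by rewrite /dot -sumrB; apply: eq_bigr => i _; rewrite !mxE mulrBl. Qed.

Lemma dotBr u v w : dot u (v - w) = dot u v - dot u w.
Proof. by rewrite /dot -sumrB; apply: eq_bigr => i _; rewrite !mxE mulrBr. Qed.

Lemma dotZr a u v : dot u (a *: v) = a * dot u v.
Proof. by rewrite /dot mulr_sumr; apply: eq_bigr => i _; rewrite !mxE mulrCA. Qed.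

Lemma enorm_ge0 u : 0 <= enorm u.
Proof. exact: sqrtr_ge0. Qed.

Lemma enorm_sqr u : enorm u ^+ 2 = dot u u.
Proof. by rewrite sqr_sqrtr// sumr_ge0// => i _; rewrite sqr_ge0. Qed.

Lemma enorm_eq0 u : enorm u = 0 -> u = 0.
Proof.
move=> /(congr1 (fun a => a ^+ 2)); rewrite enorm_sqr expr0n /= => /eqP.
rewrite psumr_eq0 => [/allP u0|i _]; last by rewrite -expr2 sqr_ge0.
apply/rowP => i; rewrite mxE; apply/eqP.
by have := u0 i (mem_index_enum i); rewrite -expr2 sqrf_eq0.
Qed.

Lemma enormZ a u : enorm (a *: u) = `|a| * enorm u.
Proof.
rewrite /enorm -sqrtr_sqr -sqrtrM ?sqr_ge0// mulr_sumr; congr Num.sqrt.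
by apply: eq_bigr => i _; rewrite mxE exprMn.
Qed.

(** Cauchy-Schwarz. For nonzero vectors, the gap times [2 * (enorm u * enorm v)] is a sum of
    squares. *)
Lemma dot_le_enorm u v : dot u v <= enorm u * enorm v.
Proof.
have [/enorm_eq0 ->|u0] := eqVneq (enorm u) 0.
  by rewrite /dot big1 ?mulr_ge0 ?enorm_ge0// => i _; rewrite mxE mul0r.
have [/enorm_eq0 ->|v0] := eqVneq (enorm v) 0.
  by rewrite /dot big1 ?mulr_ge0 ?enorm_ge0// => i _; rewrite mxE mulr0.
have uv0 : 0 < 2 * (enorm u * enorm v).
  by rewrite !mulr_gt0// lt_neqAle eq_sym ?u0 ?v0 enorm_ge0.
rewrite -subr_ge0 -(pmulr_rge0 _ uv0).
suff -> : 2 * (enorm u * enorm v) * (enorm u * enorm v - dot u v) =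
    \sum_i (enorm v * u 0 i - enorm u * v 0 i) ^+ 2.
  by apply: sumr_ge0 => i _; rewrite sqr_ge0.
rewrite [RHS](_ : _ = enorm v ^+ 2 * dot u u + enorm u ^+ 2 * dot v v
    - 2 * (enorm u * enorm v) * dot u v).
  by rewrite -!enorm_sqr; ring.
rewrite /dot !mulr_sumr -big_split -sumrB; apply: eq_bigr => i _ /=; ring.
Qed.

(** Turns the sup-norm bound contained in [bounded_set] into a Euclidean one. *)
Lemma enorm_le_norm u : enorm u <= Num.sqrt p%:R * `|u|.
Proof.
rewrite -[`|u|]ger0_norm// -sqrtr_sqr -sqrtrM ?ler0n// ler_wsqrtr//.
rewrite mulr_natl -[X in _ *+ X]card_ord -sumr_const ler_sum// => i _.
rewrite -real_normK ?num_real// lerXn2r ?nnegrE//.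
by rewrite [leRHS]mx_normrE; exact: (le_bigmax _ (fun j => `|u j.1 j.2|) (0, i)).
Qed.

Lemma derive_dot (f : 'rV[R]_p -> R) u v :
  differentiable f u -> 'D_v f u = dot (gradient f u) v.
Proof.
move=> df; rewrite deriveE// [in LHS](row_sum_delta v) linear_sum.
by apply: eq_bigr => i _; rewrite linearZ mxE deriveE//= mulrC.
Qed.

(** By convexity the difference quotient at [u] along [v - u] is at most [f v - f u] for steps in
    (0, 1]; the derivative is its limit from the right. *)
Lemma convex_ge_tangent (f : 'rV[R]_p -> R) u v :
  convex_function [set: convex_lmodType 'rV[R]_p] f ->
  differentiable f u -> f u + dot (gradient f u) (v - u) <= f v.
Proof.
move=> cf df; rewrite -derive_dot// -lerBrDl.
have dfu : derivable f u (v - u) by exact: diff_derivable.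
rewrite /derive cvg_at_rightE//.
apply: limr_le.
  by apply: cvgP; apply: cvg_dnbhs_at_right; exact: dfu.
near=> h.
have h0 : 0 < h by near: h; exact: nbhs_right_gt.
have h1 : h <= 1 by near: h; exact: nbhs_right_le.
have := cf (Itv01 (ltW h0) h1) v u; rewrite !in_setE => /(_ Logic.I Logic.I).
rewrite [X in f X](_ : _ = h *: (v - u) + u); last first.
  rewrite [LHS](_ : _ = h *: v + (1 - h) *: u)//.
  by rewrite scalerBl scale1r scalerBr addrCA addrC.
rewrite [X in _ <= X](_ : _ = h * f v + (1 - h) * f u)// => H.
rewrite /= [leLHS]/(h^-1 * _) ler_pdivrMl//; lra.
Unshelve. all: by end_near. Qed.

(* The tangent inequality at the new point replaces the usual Taylor bound; it
   only loses a factor 2 in beta, which mu < 1/beta can afford. *)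
Lemma gradient_step_descent (f : 'rV[R]_p -> R) (beta mu : R) u :
  0 <= mu -> convex_function [set: convex_lmodType 'rV[R]_p] f ->
  smooth beta f ->
  f (u - mu *: gradient f u) <=
  f u - mu * (1 - beta * mu) * enorm (gradient f u) ^+ 2.
Proof.
move=> mu0 cf [df Lf]; set g := gradient f u; set u' := u - mu *: g.
have := convex_ge_tangent u cf (df u').
have uu' : u - u' = mu *: g by rewrite /u' subKr.
(* With the Lipschitz bound this gives [dot (gradient f u') g >= (1 - beta * mu) * enorm g ^+ 2]. *)
have := dot_le_enorm (g - gradient f u') g.
have /(ler_wpM2r (enorm_ge0 g)) := Lf u u'.
rewrite uu' enormZ ger0_norm// -/g dotZr dotBl -enorm_sqr => h1 h2 h3.
have := ler_wpM2l mu0 (le_trans h2 h1); nra.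
Qed.

End Euclid.

Theorem proposition1 (R : realType) (n : nat) (X : set 'rV[R]_n) (Y : Type)
    (y : X -> Y) (loss : Y -> Y -> R) (m : nat) (x : 'I_m -> X)
    (p : nat) (Omega : Type) (G : 'rV[R]_p -> X -> Y) (T : Omega -> X -> Y)
    (beta mu : R) (theta : nat -> 'rV[R]_p) (omega : nat -> Omega)
    (Q := total_risk loss x y G T) :
  (0 < m)%N ->
  (forall a b, 0 <= loss a b) ->
  0 < beta ->
  (forall w, convex_function [set: convex_lmodType 'rV[R]_p] (Q ^~ w)
             /\ smooth beta (Q ^~ w)) ->
  (forall w, argmin (Q ^~ w) !=set0) ->
  bounded_set (\bigcup_(w in [set: Omega]) argmin (Q ^~ w)) ->
  (forall th, argmin (fun w => empirical_risk loss x (G th) (T w)) !=set0) ->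
  coercive (fun th => empirical_risk loss x (G th) y) ->
  0 < mu < beta^-1 ->
  (forall t, (1 <= t)%N -> argmin (Q (theta t)) (omega t)) ->
  (forall t, (2 <= t)%N ->
    theta t = theta t.-1 - mu *: gradient (Q ^~ (omega t.-1)) (theta t.-1)) ->
  exists l : R,
    [/\ (fun t => Q (theta t) (omega t)) @ \oo --> l,
        (fun t => minval (Q ^~ (omega t))) @ \oo --> l
      & (fun t => minval (Q (theta t))) @ \oo --> l].
Proof.
move=> m0 loss0 beta0 cvx_smooth argminQ bndQ argminT coerG /andP[mu0 muB].
move=> omegaP thetaP.
have risk_ge0 H H' : 0 <= empirical_risk loss x H H'.
  by rewrite mulr_ge0 ?invr_ge0 ?sumr_ge0.
(* Indices are shifted by one: the hypotheses leave [theta 0] and [omega 0] arbitrary. *)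
pose q t := Q (theta t.+1) (omega t.+1).
pose g t := gradient (Q ^~ (omega t.+1)) (theta t.+1).
pose c := mu * (1 - beta * mu).
have c0 : 0 < c.
  by rewrite mulr_gt0// subr_gt0 mulrC -ltr_pdivlMr// mul1r.
have stepq t : c * enorm (g t) ^+ 2 <= q t - q t.+1.
  have [cvxQ smoothQ] := cvx_smooth (omega t.+1).
  have := gradient_step_descent (theta t.+1) (ltW mu0) cvxQ smoothQ.
  rewrite -/(g t) -/(q t) -/c -[theta t.+1 - _](thetaP t.+2)// => qt.
  have := omegaP t.+2 isT (omega t.+1); rewrite -/(q t.+1); lra.
have q_noninc : {homo q : s t / (s <= t)%N >-> t <= s}.
  apply/nonincreasing_seqP => t; rewrite -subr_ge0; apply: le_trans (stepq t).
  by rewrite mulr_ge0 ?sqr_ge0// ltW.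
have cvgq : cvgn q.
  apply: nonincreasing_is_cvgn => //.
  by exists 0 => _ [t _ <-]; exact: addr_ge0.
have {cvgq} [l cvgq] : exists l : R, q @ \oo --> l by exists (limn q).
have [r rP] : exists r, forall t, enorm (theta t.+1) <= r.
  (* The risk against [y] is at most [q t], hence at most [q 0], so no iterate leaves the coercivity
     radius of that level. *)
  have [r rP] := coerG (q 0%N); exists r => t.
  rewrite leNgt; apply/negP => /rP; apply/negP; rewrite -leNgt.
  by apply: le_trans (q_noninc _ _ (leq0n t)); rewrite lerDl.
have [M MP] : exists M, forall w th, argmin (Q ^~ w) th -> enorm th <= M.
  (* [bounded_set] only provides bounds strictly above [M], hence [M + 1]. *)
  have [M [_ MP]] := bndQ; exists (Num.sqrt p%:R * (M + 1)) => w th thP.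
  apply: le_trans (enorm_le_norm th) _; apply: ler_wpM2l; first exact: sqrtr_ge0.
  by apply: (MP (M + 1)); [rewrite ltrDl|exists w].
have gapq t : 0 <= q t - minval (Q ^~ (omega t.+1)) <=
    (r + M) * Num.sqrt (c^-1 * (q t - q t.+1)).
  have [th thP] := argminQ (omega t.+1); rewrite (minvalE thP).
  apply/andP; split; first by rewrite subr_ge0; exact: thP.
  have [cvxQ [dQ _]] := cvx_smooth (omega t.+1).
  have := convex_ge_tangent th cvxQ (dQ (theta t.+1)).
  rewrite -/(g t) -/(q t) => tangent.
  have gt : enorm (g t) <= Num.sqrt (c^-1 * (q t - q t.+1)).
    rewrite -[enorm (g t)]ger0_norm ?enorm_ge0// -sqrtr_sqr ler_wsqrtr//.
    by rewrite ler_pdivlMl.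
  rewrite dotBr in tangent.
  have gtheta := dot_le_enorm (g t) (theta t.+1).
  (* The tangent inequality requires an upper bound on [- dot (g t) th], hence the opposite
     vector. *)
  have gth := dot_le_enorm (g t) (-1 *: th).
  rewrite dotZr enormZ normrN1 mul1r in gth.
  apply: (@le_trans _ _ ((r + M) * enorm (g t))).
    have := ler_wpM2l (enorm_ge0 (g t)) (rP t).
    have := ler_wpM2l (enorm_ge0 (g t)) (MP _ _ thP); lra.
  apply: ler_wpM2l gt; rewrite addr_ge0//.
    exact: le_trans (enorm_ge0 _) (rP 0%N).
  exact: le_trans (enorm_ge0 _) (MP _ _ thP).
have sqrt_cvg0 :
    (r + M) * Num.sqrt (c^-1 * (q t - q t.+1)) @[t --> \oo] --> 0.
  (* Both [q t] and [q t.+1] tend to [l]; writing 0 in this form lets the limit pass through the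
     continuous square root. *)
  have -> : 0 = (r + M) * Num.sqrt (c^-1 * (l - l)).
    by rewrite subrr mulr0 sqrtr0 mulr0.
  apply: cvgMl_tmp.
  apply: (continuous_cvg _ (@sqrt_continuous R _)).
  by apply: cvgMl_tmp; apply: cvgB => //; rewrite (cvg_shiftS q).
have gap_cvg0 : q t - minval (Q ^~ (omega t.+1)) @[t --> \oo] --> 0.
  by apply: squeeze_cvgr (cvg_cst 0) sqrt_cvg0; apply: nearW.
have min_cvg : (fun t => minval (Q ^~ (omega t.+1))) @ \oo --> l.
  rewrite (_ : (fun t => _) =
    (fun t => q t - (q t - minval (Q ^~ (omega t.+1))))); last first.
    by apply/funext => t; rewrite subKr.
  by rewrite -[l]subr0; apply: cvgB.
exists l; split; rewrite -cvg_shiftS//.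
(* Only the third limit remains: [omega t.+1] attains the minimum over [Omega], so this sequence is
   [q] itself. *)
rewrite (_ : [sequence _]_n = q)//; apply/funext => t /=.
by rewrite (minvalE (omegaP t.+1 _)).
Qed.
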